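(* Let $f(X)=a_{0}+a_{1}X+\cdots +a_{n}X^{n}\in \mathbb{Z}[X]$, $a_{0}a_{n}\neq 0$. Suppose there exist two distinct prime numbers $p$ and $q$ and an index $j\ge 0$ with $j<\frac{n}{\gcd(\nu _{q}(a_{n}),n)}$ such that (i) $\nu _{p}(a_{i})=0$ for all $0\le i\leq j$, $\frac{\nu _{p}(a_{i})}{i-j}>\frac{\nu _{p}(a_{n})}{n-j}$ for $j<i<n$, and $\nu _{p}(a_{n})>0$; (ii) $\nu _{q}(a_{0})=0$, $\frac{\nu _{q}(a_{i})}{i}\geq\frac{\nu _{q}(a_{n})}{n}$ for all $0<i\le n$, and $\nu _{q}(a_{n})>0$; (iii) $\gcd(\nu _{p}(a_{n}),n-j)=1$. Then $f$ is irreducible over $\mathbb{Q}$.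
   Context: For a prime $p$ and a nonzero integer $m$, $\nu_p(m)$ is the largest integer $i$ such that $p^i\mid m$; by convention $\nu_p(0)=\infty$ (so lower bounds on $\nu_p(a_i)$ hold automatically when $a_i=0$). *)

(* Defs.v *)
From mathcomp Require Import all_boot all_order all_algebra.
From mathcomp Require Import constructive_ereal.

Set Implicit Arguments.
Unset Strict Implicit.
Unset Printing Implicit Defensive.

Import Order.TTheory GRing.Theory Num.Theory.

Local Open Scope ring_scope.

(* [logn p 0] is 0 in MathComp, hence the separate case giving the convention
   that the valuation of 0 is infinite. *)
Definition padic_val (p : nat) (m : int) : \bar rat :=
  if m == 0 then +oo%E else ((logn p `|m|%N)%:R)%:E%E.

(* Main.v *)
(** A segment of slope [V / e] of the Newton polygon of [f] at a prime is a level
    set of the weight [e v(a_i) - V i] at its minimum.  By Dumas, if [f = g h], the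
    first and last indices where this weight is minimal add up over [g] and [h].
    At [q] the polygon of [f] is the single segment from [0] to [n], which forces
    [n / gcd(v_q(a_n), n)] to divide the degree of each factor, so a nonconstant
    factor has degree greater than [j].  At [p] the segment from [j] to [n] contains
    no interior lattice point, so it belongs entirely to one factor and the other
    factor has degree at most [j]. *)

Require Import Defs.
From mathcomp Require Import all_boot all_order all_algebra.
From mathcomp Require Import constructive_ereal.
From mathcomp Require Import zify.

Set Implicit Arguments.
Unset Strict Implicit.
Unset Printing Implicit Defensive.

Import Order.TTheory GRing.Theory Num.Theory.

Local Open Scope ring_scope.

(** * Linear weights on coefficients and their strict minima *)

Local Notation vp p m := (logn p (absz m%R)).

(* Meaningless at [x = 0], where the true weight is infinite. *)
Definition wt (p : nat) (A B x : int) (i : nat) : int :=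
  A * (vp p x)%:Z + B * i%:Z.

Definition strict_argmin (p : nat) (A B : int) (g : {poly int}) (a : nat) :=
  g`_a != 0 /\
  forall i, g`_i != 0 -> i != a -> wt p A B g`_a a < wt p A B g`_i i.

Lemma strict_argmin_inj p A B g a b :
  strict_argmin p A B g a -> strict_argmin p A B g b -> a = b.
Proof.
move=> [ga mina] [gb minb]; apply/eqP; apply: contraT => ab.
by have := lt_trans (mina b gb _) (minb a ga ab); rewrite ltxx eq_sym => ->.
Qed.

Lemma dvdz_pfactor p k (m : int) : prime p -> m != 0 ->
  ((p ^ k)%N %| m)%Z = (k <= vp p m)%N.
Proof. by move=> pp m0; rewrite dvdzE pfactor_dvdn // absz_gt0. Qed.

Lemma wtM p A B (x y : int) i k : prime p -> x != 0 -> y != 0 ->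
  wt p A B (x * y) (i + k) = wt p A B x i + wt p A B y k.
Proof.
move=> pp x0 y0; rewrite /wt abszM lognM ?absz_gt0 // !PoszD !mulrDr.
by rewrite addrACA.
Qed.

Lemma ltr_wt p (A B x y : int) i : 0 < A ->
  (wt p A B x i < wt p A B y i) = (vp p x < vp p y)%N.
Proof. by move=> A0; rewrite /wt ltrD2r ltr_pM2l. Qed.

Lemma ler_wt p (A B x y : int) i : 0 < A ->
  (wt p A B x i <= wt p A B y i) = (vp p x <= vp p y)%N.
Proof. by move=> A0; rewrite /wt lerD2r ler_pM2l. Qed.

(** Weights add under products, so the pair [(a, b)] is strictly lighter than any other pair of
    indices: nothing can cancel it in coefficient [a + b], and every other coefficient is a sum of
    heavier terms. *)
Lemma strict_argminM p (A B : int) g h a b : prime p -> 0 < A ->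
  strict_argmin p A B g a -> strict_argmin p A B h b ->
  strict_argmin p A B (g * h) (a + b).
Proof.
move=> pp A0 [ga mina] [hb minb].
have gh0 : g`_a * h`_b != 0 by rewrite mulf_neq0.
have lt_ab i k : g`_i * h`_k != 0 -> (i != a) || (k != b) ->
    wt p A B (g`_a * h`_b) (a + b) < wt p A B (g`_i * h`_k) (i + k).
  rewrite mulf_eq0 negb_or => /andP[gi hk] ik; rewrite !wtM //.
  have [ia|/(mina _ gi) lta] := eqVneq i a; last first.
    apply: ltr_leD => //.
    by have [->|/(minb _ hk)/ltW] := eqVneq k b.
  by move: ik; rewrite ia eqxx /= => /(minb _ hk); rewrite ltrD2l.
(* All other terms of the convolution sum are divisible by [p ^ v.+1], the main one is not;
   non-divisibility also shows that the sum is nonzero. *)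
have [le_ab f0] : (vp p (g * h)`_(a + b)%N <= vp p (g`_a * h`_b)%R)%N /\
    (g * h)`_(a + b) != 0.
  set v := vp p (g`_a * h`_b)%R.
  suff ndvd : ~~ ((p ^ v.+1)%N %| (g * h)`_(a + b))%Z.
    have f0 : (g * h)`_(a + b) != 0 by apply: contraNneq ndvd => ->; apply: dvdz0.
    by rewrite leqNgt -dvdz_pfactor.
  have lt_a : (a < (a + b).+1)%N by rewrite ltnS leq_addr.
  rewrite coefM (bigD1 (Ordinal lt_a)) //= addKn rpredDr.
    by rewrite dvdz_pfactor // ltnn.
  apply: rpred_sum => i; rewrite -val_eqE /= => ia.
  have [->|gh] := eqVneq (g`_i * h`_(a + b - i)) 0; first exact: dvdz0.
  rewrite dvdz_pfactor // -(ltr_wt p B _ _ (a + b) A0).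
  have := lt_ab _ _ gh; rewrite ia subnKC -1?ltnS ?ltn_ord //; exact.
split=> // l fl lab.
set u := vp p (g * h)`_l.
have ndvd : ~~ ((p ^ u.+1)%N %| (g * h)`_l)%Z by rewrite dvdz_pfactor // ltnn.
(* Some term of the sum has valuation at most [u], so its weight bounds that of the coefficient from
   below. *)
have /existsP[i ndi] :
    [exists i : 'I_l.+1, ~~ ((p ^ u.+1)%N %| g`_i * h`_(l - i))%Z].
  rewrite -negb_forall; apply: contra ndvd => /forallP dv.
  by rewrite coefM; apply: rpred_sum.
have gh : g`_i * h`_(l - i) != 0 by apply: contraNneq ndi => ->; apply: dvdz0.
rewrite dvdz_pfactor // -ltnNge ltnS -(ler_wt p B _ _ l A0) in ndi.
rewrite -(ler_wt p B _ _ (a + b) A0) in le_ab.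
have il : (i <= l)%N by rewrite -ltnS.
apply: le_lt_trans le_ab (lt_le_trans _ ndi).
have := lt_ab _ _ gh; rewrite subnKC //; apply.
by rewrite -negb_and; apply: contra lab => /andP[/eqP <- /eqP <-]; rewrite subnKC.
Qed.

Lemma coef_neq0_lt (R : nzRingType) (g : {poly R}) i :
  g`_i != 0 -> (i < size g)%N.
Proof. by rewrite ltnNge; apply: contra => /leq_sizeP ->. Qed.

(* Perturbing the slope by [1 / N] makes the weights of distinct indices below [N]
   distinct modulo [N]: this selects the first ([s = 1]) or last ([s = -1]) index
   of minimal weight. *)
Lemma exists_strict_argmin p (N : nat) (e B s : int) (g : {poly int}) :
  (size g <= N)%N -> g != 0 -> s = 1 \/ s = -1 ->
  exists a, strict_argmin p (e * N%:Z) (B * N%:Z + s) g a.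
Proof.
move=> sN g0 s1.
have lead : g`_(size g).-1 != 0 by rewrite -lead_coefE lead_coef_eq0.
have i0P := coef_neq0_lt lead.
pose F (i : 'I_(size g)) := wt p (e * N%:Z) (B * N%:Z + s) g`_i i.
case: (Order.TotalTheory.arg_minP F (i0 := Ordinal i0P)
  (P := fun i => g`_i != 0) lead) => a ga mina; exists a; split=> // i gi ia.
have ilt := coef_neq0_lt gi.
rewrite lt_neqAle (mina (Ordinal ilt) gi) andbT /F /wt.
apply/eqP => E.
have lta := ltn_ord a.
(* Equal weights would make [N] divide [s * (a - i)], although [0 < |a - i| < N]. *)
have : (N %| (s * (a%:Z - i%:Z))%R)%Z.
  apply/dvdzP.
  exists (e * (vp p g`_i)%:Z + B * i%:Z - e * (vp p g`_a)%:Z - B * a%:Z); nia.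
rewrite dvdzE abszM /= => dv.
have pos : (0 < absz s * absz (a%:Z - i%:Z)%R)%N.
  rewrite muln_gt0 !absz_gt0 subr_eq0 eqz_nat (eq_sym (nat_of_ord a)) ia.
  by case: s1 => ->.
have := dvdn_leq pos dv; have := leq_trans lta sN; have := leq_trans ilt sN.
by case: s1 => ->; rewrite ?absz1 ?abszN1 mul1n; lia.
Qed.

(** * Newton polygon edges of a product *)

Definition on_segment p (e V : int) (g : {poly int}) (a b : nat) :=
  [/\ g`_a != 0, g`_b != 0, (a <= b)%N
    & wt p e (- V) g`_a a = wt p e (- V) g`_b b].

Definition newton_edge p (e V : int) (f : {poly int}) (s t : nat) :=
  [/\ on_segment p e V f s t,
      forall i, f`_i != 0 -> wt p e (- V) f`_s s <= wt p e (- V) f`_i i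
    & forall i, f`_i != 0 -> (i < s)%N || (t < i)%N ->
        wt p e (- V) f`_s s < wt p e (- V) f`_i i].

(** Tilting the slope by [1 / N] either way turns both ends of the edge into strict minima. These
    add up under products, and uniqueness identifies the sums with [s] and [t]. *)
Lemma newton_edgeM p (e V : int) (g h : {poly int}) (s t : nat) :
  prime p -> 0 < e -> newton_edge p e V (g * h) s t ->
  exists a b c d, [/\ (a + c = s)%N, (b + d = t)%N,
    on_segment p e V g a b & on_segment p e V h c d].
Proof.
move=> pp e0 [[fs ft st wst] minf sminf].
have gh0 : g * h != 0 by apply: contraNneq fs => ->; rewrite coef0.
have [g0 h0] : g != 0 /\ h != 0 by apply/andP; rewrite -negb_or -mulf_eq0.
pose N := maxn (maxn (size g) (size h)) (size (g * h)).
have sgN : (size g <= N)%N by rewrite !leq_max leqnn.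
have shN : (size h <= N)%N by rewrite !leq_max leqnn orbT.
have sfN : (size (g * h)%R <= N)%N by rewrite leq_max leqnn orbT.
have ltN (k : {poly int}) i : (size k <= N)%N -> k`_i != 0 -> (i < N)%N.
  by move=> kN /coef_neq0_lt ik; apply: leq_trans ik kN.
have N0 : 0 < N%:Z by have := ltN _ _ sfN fs; lia.
have A0 : 0 < e * N%:Z by rewrite mulr_gt0.
have wtE u x i : wt p (e * N%:Z) (- V * N%:Z + u) x i
    = N%:Z * wt p e (- V) x i + u * i%:Z by rewrite /wt; lia.
have fmin_s : strict_argmin p (e * N%:Z) (- V * N%:Z + 1) (g * h) s.
  split=> // i fi si; rewrite !wtE !mul1r.
  have iN := ltN _ _ sfN fi; have sN := ltN _ _ sfN fs.
  have := minf _ fi; have := sminf _ fi; case: (ltnP i s) => /=; last by nia.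
  by move=> ? /(_ isT); nia.
have fmin_t : strict_argmin p (e * N%:Z) (- V * N%:Z + -1) (g * h) t.
  split=> // i fi ti; rewrite !wtE !mulN1r -wst.
  have iN := ltN _ _ sfN fi; have tN := ltN _ _ sfN ft.
  have := minf _ fi; have := sminf _ fi; case: (ltnP t i) => /=; last by nia.
  by rewrite orbT => ? /(_ isT); nia.
have ex (k : {poly int}) : (size k <= N)%N -> k != 0 -> exists a b,
    [/\ strict_argmin p (e * N%:Z) (- V * N%:Z + 1) k a,
    strict_argmin p (e * N%:Z) (- V * N%:Z + -1) k b & on_segment p e V k a b].
  move=> sk k0.
  have [a [ka mina]] := exists_strict_argmin p e (- V) sk k0 (or_introl erefl).
  have [b [kb minb]] := exists_strict_argmin p e (- V) sk k0 (or_intror erefl).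
  exists a, b; split=> //.
  have [ab|ab] := eqVneq a b; first by rewrite /on_segment -ab.
  have aN := ltN _ _ sk ka; have bN := ltN _ _ sk kb.
  have := minb _ ka ab; have := mina _ kb; rewrite eq_sym ab => /(_ isT).
  rewrite !wtE => H1 H2.
  (* The two minimality conditions bound [N] times the difference of the weights by [|b - a| < N],
     so this integer difference is zero. *)
  have wab : wt p e (- V) k`_a a = wt p e (- V) k`_b b by nia.
  by split=> //; rewrite wab in H1; lia.
have [a [b [mina minb gab]]] := ex g sgN g0.
have [c [d [minc mind hcd]]] := ex h shN h0.
exists a, b, c, d; split=> //.
  exact: strict_argmin_inj (strict_argminM pp A0 mina minc) fmin_s.
exact: strict_argmin_inj (strict_argminM pp A0 minb mind) fmin_t.
Qed.

(** Equal weights mean that [V * (b - a)] is [e] times the difference of the valuations. *)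
Lemma on_segment_dvdn p (e V : nat) (g : {poly int}) a b :
  on_segment p e V g a b -> (e %| V * (b - a))%N.
Proof.
move=> [_ _ ab]; rewrite /wt => wab.
suff : (e%:Z %| (V * (b - a))%N%:Z)%Z by [].
apply/dvdzP; exists ((vp p g`_b)%:Z - (vp p g`_a)%:Z).
by rewrite PoszM -subzn //; move: wab; lia.
Qed.

(** * From extended rational slopes to inequalities between naturals *)

Lemma padic_valE p (m : int) : m != 0 -> padic_val p m = ((vp p m)%:R)%:E.
Proof. by rewrite /padic_val => /negbTE ->. Qed.

Lemma natr_diveE (x d : nat) : (0 < d)%N ->
  ((x%:R)%:E / (d%:R)%:E)%E = (x%:R / d%:R)%:E :> \bar rat.
Proof. by move=> d0; rewrite inver pnatr_eq0 eqn0Ngt d0 EFinM. Qed.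

Lemma lte_natr_div (x y d d' : nat) : (0 < d)%N -> (0 < d')%N ->
  ((x%:R)%:E / (d%:R)%:E < (y%:R)%:E / (d'%:R)%:E :> \bar rat)%E
  = (x * d' < y * d)%N.
Proof.
move=> d0 d'0; rewrite !natr_diveE // lte_fin ltr_pdivrMr ?ltr0n //.
by rewrite mulrAC ltr_pdivlMr ?ltr0n // -!natrM ltr_nat.
Qed.

Lemma lee_natr_div (x y d d' : nat) : (0 < d)%N -> (0 < d')%N ->
  ((x%:R)%:E / (d%:R)%:E <= (y%:R)%:E / (d'%:R)%:E :> \bar rat)%E
  = (x * d' <= y * d)%N.
Proof.
move=> d0 d'0; rewrite !natr_diveE // lee_fin ler_pdivrMr ?ltr0n //.
by rewrite mulrAC ler_pdivlMr ?ltr0n // -!natrM ler_nat.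
Qed.

Lemma padic_val_eq0 p (m : int) : padic_val p m = 0%E -> m != 0 /\ vp p m = 0%N.
Proof.
rewrite /padic_val; case: eqVneq => // _ /eqP.
by rewrite eqe pnatr_eq0 => /eqP.
Qed.

(** Gauss's lemma: a rational divisor of [f] is a scalar multiple of an integer polynomial dividing
    [f] over the integers. *)
Lemma irreducible_poly_int_factor (f : {poly int}) : (1 < size f)%N ->
  (forall g h : {poly int}, f = g * h -> (size g <= 1)%N \/ (size h <= 1)%N) ->
  irreducible_poly (map_poly (intr : int -> rat) f).
Proof.
move=> f1 fP.
have f0 : f != 0 by rewrite -size_poly_gt0 ltnW.
split=> [|d d1 /dvdpP_rat_int[g [c c0 dE] [h fE]]].
  by rewrite size_rat_int_poly.
move: d1; rewrite dE size_scale // size_rat_int_poly => g1.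
have g0 : g != 0 by apply: contraNneq f0 => g0; rewrite fE g0 mul0r.
have h0 : h != 0 by apply: contraNneq f0 => h0; rewrite fE h0 mulr0.
apply: (eqp_trans (eqp_scale _ c0)).
have [|h1] := fP _ _ fE.
  by move: g1 g0; rewrite -size_poly_gt0; case: (size g) => [|[]].
have /size_poly1P[a a0 hE] : size h == 1%N.
  by rewrite eqn_leq h1 size_poly_gt0.
by rewrite fE hE mulrC mul_polyC map_polyZ eqp_sym eqp_scale // intr_eq0.
Qed.

Theorem theorem1p12 (f : {poly int}) (n p q j : nat)
  (size_f : size f = n.+1) (f0_neq0 : f`_0 != 0)
  (p_prime : prime p) (q_prime : prime q) (p_neq_q : p != q)
  (j_lt : j%:R < n%:R / (gcdn (logn q (absz f`_n)) n)%:R :> rat)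
  (p_val_low : forall i : nat, (i <= j)%N -> padic_val p f`_i = 0%E)
  (p_val_mid : forall i : nat, (j < i < n)%N ->
    (padic_val p f`_n / ((n - j)%N%:R)%:E
       < padic_val p f`_i / ((i - j)%N%:R)%:E)%E)
  (p_val_lead : (0 < padic_val p f`_n)%E)
  (q_val_0 : padic_val q f`_0 = 0%E)
  (q_val : forall i : nat, (0 < i <= n)%N ->
    (padic_val q f`_n / (n%:R)%:E <= padic_val q f`_i / (i%:R)%:E)%E)
  (q_val_lead : (0 < padic_val q f`_n)%E)
  (p_coprime : gcdn (logn p (absz f`_n)) (n - j) = 1%N) :
  irreducible_poly (map_poly (intr : int -> rat) f).
Proof.
set G := gcdn _ n in j_lt.
have fn0 : f`_n != 0.
  by rewrite -[n]/(n.+1.-1) -size_f -lead_coefE lead_coef_eq0 -size_poly_gt0 size_f.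
have le_n i : f`_i != 0 -> (i <= n)%N by move/coef_neq0_lt; rewrite size_f.
have n0 : (0 < n)%N.
  by rewrite lt0n; apply: contraTneq j_lt => ->; rewrite mul0r -leNgt ler0n.
have G0 : (0 < G)%N by rewrite gcdn_gt0 n0 orbT.
have jG_lt : (j * G < n)%N.
  by move: j_lt; rewrite ltr_pdivlMr ?ltr0n // -natrM ltr_nat.
have jn : (j < n)%N by apply: leq_ltn_trans jG_lt; rewrite leq_pmulr.
set V := vp p f`_n in p_coprime.
have V0 : (0 < V)%N by move: p_val_lead; rewrite padic_valE // lte_fin ltr0n.
(* The minimal weight is [- V * j]; for [i < j] the valuation vanishes and the weight [- V * i] is
   larger because [V > 0]. *)
have p_edge : newton_edge p (n - j)%N V f j n.
  have [fj0 vj] := padic_val_eq0 (p_val_low j (leqnn j)).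
  have wtj : wt p (n - j)%N (- V%:Z) f`_j j = - V%:Z * j%:Z.
    by rewrite /wt vj mulr0 add0r.
  have wtn : wt p (n - j)%N (- V%:Z) f`_n n = - V%:Z * j%:Z.
    by rewrite /wt -/V; lia.
  have lt_low i : (i < j)%N -> - V%:Z * j%:Z < wt p (n - j)%N (- V%:Z) f`_i i.
    move=> ij; rewrite /wt.
    by have [_ ->] := padic_val_eq0 (p_val_low i (ltnW ij)); nia.
  split=> [|i fi|i fi].
  - by split; rewrite ?wtn // ltnW.
  - rewrite wtj; have [/lt_low/ltW//|ji|->] := ltngtP i j; last by rewrite wtj.
    have := le_n _ fi; rewrite leq_eqVlt => /predU1P[->|iltn]; first by rewrite wtn.
    have := p_val_mid i; rewrite ji iltn => /(_ isT).
    rewrite !padic_valE // lte_natr_div ?subn_gt0 // -/V /wt => V_lt.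
    by nia.
  - by rewrite ltnNge [(n < i)%N]ltnNge (le_n _ fi) orbF -ltnNge wtj => /lt_low.
have q_edge : newton_edge q n (vp q f`_n) f 0 n.
  have [_ v0] := padic_val_eq0 q_val_0.
  split=> [|i fi|i fi].
  - by split=> //; rewrite /wt v0; lia.
  - have [->//|i0] := posnP i.
    have := q_val i; rewrite i0 le_n // => /(_ isT).
    by rewrite !padic_valE // lee_natr_div // /wt v0; lia.
  - by rewrite ltn0 ltnNge (le_n _ fi).
apply: irreducible_poly_int_factor => [|g h fE]; first by rewrite size_f.
have degM : ((size g).-1 + (size h).-1 = n)%N.
  have f0 : g * h != 0 by rewrite -fE -size_poly_gt0 size_f.
  have [g0 h0] : g != 0 /\ h != 0 by apply/andP; rewrite -negb_or -mulf_eq0.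
  move: g0 h0 (size_mul g0 h0); rewrite -fE size_f -!size_poly_gt0.
  by move: (size g) (size h) => x y; lia.
have le_deg (k : {poly int}) i : k`_i != 0 -> (i <= (size k).-1)%N.
  by move/coef_neq0_lt; case: (size k).
(* Right ends are bounded by the degrees and have the same sum [n], hence equal them. *)
have endE b d : g`_b != 0 -> h`_d != 0 -> (b + d = n)%N ->
    b = (size g).-1 /\ d = (size h).-1.
  by move=> /le_deg + /le_deg; move: degM; clear; lia.
(* Here [n] divides [G * deg k], while [deg k <= j] gives [G * deg k <= j * G < n]; so
   [deg k = 0]. *)
have q_deg (k : {poly int}) a b : (a = 0)%N -> b = (size k).-1 ->
    on_segment q n (vp q f`_n) k a b -> ((size k).-1 <= j)%N -> (size k <= 1)%N.
  move=> -> -> /on_segment_dvdn; rewrite subn0 => dv degk.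
  rewrite -subn_eq0 subn1 eqn0Ngt; apply/negP => deg0.
  have : (n %| G * (size k).-1)%N.
    by rewrite muln_gcdl dvdn_gcd dv dvdn_mulr.
  by move/dvdn_leq; rewrite muln_gt0 G0 deg0 => /(_ isT); nia.
(* The occurrence of [f] inside the slope at [q] stays, to match [q_deg]. *)
move: p_edge q_edge; rewrite {1 3}fE => p_edge q_edge.
have n0z : 0 < n%:Z by rewrite ltz_nat.
have e0 : 0 < (n - j)%N%:Z by rewrite ltz_nat subn_gt0.
have [a [b [c [d [ac bd gab hcd]]]]] := newton_edgeM p_prime e0 p_edge.
have [a' [b' [c' [d' [ac' bd' gab' hcd']]]]] := newton_edgeM q_prime n0z q_edge.
have [gb hd] : g`_b != 0 /\ h`_d != 0 by case: gab hcd => [_ ? _ _] [].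
have [gb' hd'] : g`_b' != 0 /\ h`_d' != 0 by case: gab' hcd' => [_ ? _ _] [].
have [ab cd] : (a <= b)%N /\ (c <= d)%N by case: gab hcd => [_ _ ? _] [].
have [bE dE] := endE _ _ gb hd bd.
have [bE' dE'] := endE _ _ gb' hd' bd'.
have co : coprime (n - j) V by rewrite coprime_sym /coprime p_coprime.
have := on_segment_dvdn gab; have := on_segment_dvdn hcd.
rewrite !Gauss_dvdr // => dv_h dv_g.
have /andP[/eqP a'0 /eqP c'0] : (a' == 0)%N && (c' == 0)%N.
  by rewrite -addn_eq0 ac'.
(* Both [b - a] and [d - c] are multiples of [n - j] and their sum is [n - j], so one vanishes. If
   [b = a], then [deg g = a <= a + c = j]; likewise for [h]. *)
have [ba|ba] := posnP (b - a); [left|right].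
  apply: (q_deg g a' b') => //; rewrite -bE.
  by move: ab ba ac; clear; lia.
apply: (q_deg h c' d') => //; rewrite -dE.
have [dc|dc] := posnP (d - c); first by move: cd dc ac; clear; lia.
have := dvdn_leq ba dv_g; have := dvdn_leq dc dv_h.
by move: ac bd jn ab cd; clear; lia.
Qed.
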